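(* Let $-\infty\le x^{\min}\le 0$ and $1\le x^{\max}\le\infty$ be (possibly infinite valued) integers, let $I=(x^{\min}-1,\,x^{\max}+1)\cap\mathbb{Z}$, and let $f:I\to[0,\infty)$ satisfy $f(x)>0$ for all $x\in I$ with $x>x^{\min}$, and $\underline\theta<0<\bar\theta$. For $\varrho$ in the range of $\varrho(\cdot)$ let $\nu^{\theta(\varrho)}$ be the probability measure $$\nu^{\theta(\varrho)}(y)=\frac{1}{\mathbf{Var}^{\theta(\varrho)}X}\sum_{x=y+1}^{x^{\max}}\bigl[x-\mathbf{E}^{\theta(\varrho)}X\bigr]\,\mu^{\theta(\varrho)}(x),\qquad y\in\mathbb{Z},\ x^{\min}\le y<x^{\max}.$$ Then the family of measures $\nu^{\theta(\varrho)}$ is monotone in $\varrho$ in the sense of stochastic domination: for every bounded non-decreasing function $\varphi$ and all $\varrho_1\le\varrho_2$ in the range of $\varrho(\cdot)$, $$\sum_{y}\varphi(y)\,\nu^{\theta(\varrho_1)}(y)\le\sum_{y}\varphi(y)\,\nu^{\theta(\varrho_2)}(y).$$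
   Context: For $x\in I$ set $f(0)!:=1$, $f(x)!:=\prod_{y=1}^{x}f(y)$ if $x>0$, and $f(x)!:=1/\prod_{y=x+1}^{0}f(y)$ if $x<0$. Let $\bar\theta:=\log\bigl(\liminf_{x\to\infty}(f(x)!)^{1/x}\bigr)$ if $x^{\max}=\infty$ and $\bar\theta:=\infty$ otherwise; let $\underline\theta:=\log\bigl(\limsup_{x\to\infty}(f(-x)!)^{-1/x}\bigr)$ if $x^{\min}=-\infty$ and $\underline\theta:=-\infty$ otherwise (with $\log 0=-\infty$, $\log\infty=\infty$). For $\underline\theta<\theta<\bar\theta$ define the probability measure $\mu^\theta$ on $I$ by $$\mu^\theta(x):=\frac{e^{\theta x}/f(x)!}{\sum_{y\in I} e^{\theta y}/f(y)!},$$ and let $\mathbf{E}^\theta$ and $\mathbf{Var}^\theta$ denote expectation and variance when $X$ has distribution $\mu^\theta$. The function $\varrho(\theta):=\mathbf{E}^\theta X$ is strictly increasing on $(\underline\theta,\bar\theta)$, and $\theta(\varrho)$ denotes its inverse function, defined on the range of $\varrho(\cdot)$. *)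

(* Defs.v *)
From HB Require Import structures.
From mathcomp Require Import all_boot all_order all_algebra.
From mathcomp Require Import all_classical all_reals all_analysis.

Set Implicit Arguments.
Unset Strict Implicit.
Unset Printing Implicit Defensive.

Import Order.TTheory GRing.Theory Num.Theory.
Import numFieldNormedType.Exports.

Local Open Scope classical_set_scope.
Local Open Scope ring_scope.

HB.instance Definition _ := isPointed.Build int 0.
HB.instance Definition _ := @isMeasurable.Build default_measure_display
  int (@discrete_measurable int) (@discrete_measurable0 int)
  (@discrete_measurableC int) (@discrete_measurableU int).

(* Sum of an absolutely summable real family over a set of integers, as the
   integral against counting measure. *)
Definition zsum (R : realType) (A : set int) (g : int -> R) : R :=
  \int[@counting int R]_(x in A) g x.

(* The possibly infinite integers x^min and x^max are elements of \bar int.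
   A function I -> [0, oo) is given by an extension to all of int, whose values
   outside of I play no role. *)
Section exponential_family.
Context (R : realType) (xmin xmax : \bar int) (f : int -> {nonneg R}).

Definition int_interval : set int :=
  [set x : int | (xmin - 1 < x%:E)%E /\ (x%:E < xmax + 1)%E].

Local Notation I := int_interval.

(* For x < 0 the product over x + 1 <= y <= 0 is reindexed by y = - k. *)
Definition ffact (x : int) : R :=
  if 0 <= x then \prod_(1 <= y < `|x|%N.+1) (f y%:Z)%:num
  else (\prod_(0 <= k < `|x|%N) (f (- k%:Z))%:num)^-1.

Lemma ffact_ge0 x : 0 <= ffact x.
Proof. by rewrite /ffact; case: ifP; rewrite ?invr_ge0 => _; apply: prodr_ge0. Qed.

Definition theta_sup : \bar R :=
  if xmax == +oo%E
  then lne (limn_einf (fun n : nat => (ffact n%:Z `^ n%:R^-1)%:E))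
  else +oo%E.

Definition theta_inf : \bar R :=
  if xmin == -oo%E
  then lne (limn_esup (fun n : nat => (ffact (- n%:Z) `^ (- n%:R^-1))%:E))
  else -oo%E.

Definition theta_dom : set R :=
  [set theta : R | (theta_inf < theta%:E)%E /\ (theta%:E < theta_sup)%E].

Definition mu (theta : R) (x : int) : R :=
  (expR (theta * x%:~R) / ffact x) /
  zsum I (fun y => expR (theta * y%:~R) / ffact y).

Lemma mu_ge0 theta x : 0 <= mu theta x.
Proof.
rewrite /mu divr_ge0 ?divr_ge0 ?expR_ge0 ?ffact_ge0//.
by apply: Rintegral_ge0 => y _; rewrite divr_ge0 ?expR_ge0 ?ffact_ge0.
Qed.

Section measure_of_mu.
Variable theta : R.

Definition mu_measure (U : set int) : \bar R :=
  (\esum_(x in U `&` I) (mu theta x)%:E)%E.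

Let mu_measure0 : mu_measure set0 = 0%E.
Proof. by rewrite /mu_measure set0I esum_set0. Qed.

Let mu_measure_ge0 U : (0 <= mu_measure U)%E.
Proof. by apply: esum_ge0 => x _; rewrite lee_fin mu_ge0. Qed.

Let mu_measure_sigma_additive : semi_sigma_additive mu_measure.
Proof.
move=> F mF tF mUF; apply: cvg_toP.
  apply: ereal_nondecreasing_is_cvgn => a b ab.
  exact: lee_sum_nneg_natr.
rewrite /mu_measure setI_bigcupl nneseries_sum_bigcup//.
- exact: trivIset_setIr.
- by move=> x; rewrite lee_fin mu_ge0.
Qed.

HB.instance Definition _ := isMeasure.Build _ _ _ mu_measure
  mu_measure0 mu_measure_ge0 mu_measure_sigma_additive.

End measure_of_mu.

(* When f > 0 on the part of I above x^min and theta is in theta_dom, the total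
   mass of mu_measure theta is 1 and mnormalize leaves it unchanged (see
   mu_probE); mnormalize only makes mu_prob total in theta. *)
Definition mu_prob (theta : R) : probability int R :=
  mnormalize (mu_measure theta) \d_(0 : int).

Lemma mu_probE theta : mu_measure theta setT = 1%E ->
  mu_prob theta = mu_measure theta :> (set int -> \bar R).
Proof.
move=> mass1; apply/funext => U.
by rewrite /mu_prob /= /mnormalize /= mass1 onee_eq0 /= invr1 mule1.
Qed.

Definition varrho (theta : R) : R := fine 'E_(mu_prob theta)[intr].

Definition mu_var (theta : R) : R := fine 'V_(mu_prob theta)[intr].

Definition theta_of (rho : R) : R := 'pinv_(cst 0) theta_dom varrho rho.

Definition nu (theta : R) (y : int) : R :=
  (mu_var theta)^-1 *
  zsum [set x : int | (y + 1 <= x) /\ (x%:E <= xmax)%E]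
    (fun x => (x%:~R - varrho theta) * mu theta x).

Definition nu_dom : set int :=
  [set y : int | (xmin <= y%:E)%E /\ (y%:E < xmax)%E].

End exponential_family.

(* Main.v *)
(* Let Phi be the discrete primitive of phi, which is convex because phi is
   nondecreasing.  Summation by parts turns the phi-average of nu^theta into
   Cov^theta(X, Phi) / Var^theta X, which is the derivative of E^theta Phi with
   respect to the mean rho; so monotonicity amounts to convexity of
   rho |-> E^{theta(rho)} Phi.  No derivative is needed: for two parameters p
   and q it suffices that the regression line of Phi on X under p, evaluated at
   the mean of q, lies below E_q Phi, and to add this inequality to the one with
   p and q exchanged.  The residual h of the regression is convex and orthogonal
   under p to the affine functions, and E_q h = E_p (L h), where L = dq/dp is an
   exponential, hence convex; that E_p (L h) >= 0 is a sign-change argument. *)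
Require Import Defs.
From HB Require Import structures.
From mathcomp Require Import all_boot all_order all_algebra.
From mathcomp Require Import all_classical all_reals all_analysis.
From mathcomp Require Import ring lra zify.

Set Implicit Arguments.
Unset Strict Implicit.
Unset Printing Implicit Defensive.

Import Order.TTheory GRing.Theory Num.Theory.
Import numFieldNormedType.Exports.

Local Open Scope classical_set_scope.
Local Open Scope ring_scope.

(** * Sums over the integers *)

Lemma measurable_set_int (A : set int) : measurable A.
Proof. by []. Qed.

Lemma measurable_fun_int d (T : measurableType d) (D : set int) (g : int -> T) :
  measurable_fun D g.
Proof. by move=> _ B _; exact: measurable_set_int. Qed.

Local Hint Resolve measurable_fun_int : core.

Lemma counting_set1 (R : realType) (x : int) : @counting int R [set x] = 1%E.
Proof. by rewrite /counting asboolT// fset_set1 finmap.cardfs1. Qed.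

(** The fibres of [pickle] are empty or singletons and cut [int] into countably many disjoint
    pieces. The measure is arbitrary because [mu_measure] is also integrated this way. *)
Lemma integral_esum (R : realType) (m : {measure set int -> \bar R})
    (f : int -> \bar R) : (forall x, 0 <= f x)%E ->
  (\int[m]_x f x = \esum_(x in setT) (f x * m [set x]))%E.
Proof.
move=> f0; pose F n := [set x : int | pickle x = n].
have FT : setT = \bigcup_n F n.
  by apply/seteqP; split => // x _; exists (pickle x).
have tF : trivIset setT F by move=> i j _ _ [x [<- <-]].
rewrite FT ge0_integral_bigcup//= nneseries_sum_bigcup//; last first.
  by move=> x; rewrite mule_ge0.
apply: eq_eseriesr => n _.
have [[x xn]|Fn0] := pselect (exists x, F n x).
  have -> : F n = [set x].
    apply/seteqP; split => y /=; last by move->.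
    by rewrite /F/= -xn => /(pcan_inj pickleK).
  rewrite esum_set1 ?mule_ge0//.
  rewrite (eq_integral (cst (f x))); last by move=> y; rewrite inE => ->.
  by rewrite integral_cst.
have -> : F n = set0 by rewrite -subset0 => x Fx; apply: Fn0; exists x.
by rewrite integral_set0 esum_set0.
Qed.

Lemma integral_counting_esum (R : realType) (f : int -> \bar R) :
  (forall x, 0 <= f x)%E ->
  (\int[@counting int R]_x f x = \esum_(x in setT) f x)%E.
Proof.
move=> f0; rewrite integral_esum//.
by apply: eq_esum => x _; rewrite /= counting_set1 mule1.
Qed.

(** Tonelli: both sides become one sum over pairs, reindexed by the swap of coordinates. *)
Lemma integral_counting_exchange (R : realType) (a : int -> int -> \bar R) :
  (forall x y, 0 <= a x y)%E ->
  (\int[@counting int R]_x \int[@counting int R]_y a x y =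
   \int[@counting int R]_y \int[@counting int R]_x a x y)%E.
Proof.
move=> a0; rewrite !integral_counting_esum; first last.
- by move=> x; exact: integral_ge0.
- by move=> x; exact: integral_ge0.
under eq_esum do rewrite integral_counting_esum//.
under [RHS]eq_esum do rewrite integral_counting_esum//.
rewrite !esum_esum//; apply: (reindex_esum _ _ (fun p => (p.2, p.1))) => //.
split=> //.
- by move=> [? ?] [? ?] _ _ /= [-> ->].
- by move=> [x y] _; exists (y, x).
Qed.

Lemma counting_integral_ge (R : realType) (f : int -> \bar R) (x : int) :
  (forall y, 0 <= f y)%E -> (f x <= \int[@counting int R]_y f y)%E.
Proof.
move=> f0; rewrite integral_counting_esum//; apply: esum_ge.
by exists [set x]; rewrite ?fsbig_set1//; split.
Qed.

(** Always over all of [int]; [zsumE] brings sums over a subset to this form by extending with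
    zero. *)
Definition zsummable (R : realType) (g : int -> R) : Prop :=
  (@counting int R).-integrable setT (EFin \o g).

Section zsum_theory.
Context {R : realType}.
Implicit Types (f g : int -> R) (a b : int -> int -> R).

Lemma zsummableP g :
  zsummable g <-> (\int[@counting int R]_x `|g x|%:E < +oo)%E.
Proof. by split=> [/integrableP[]//|goo]; apply/integrableP. Qed.

Lemma zsummable_le f g :
  (forall x, `|f x| <= `|g x|) -> zsummable g -> zsummable f.
Proof.
by move=> fg; apply: le_integrable => // x _; rewrite lee_fin.
Qed.

Lemma zsummableN g : zsummable g -> zsummable (fun x => - g x).
Proof. by apply: zsummable_le => x; rewrite normrN. Qed.

Lemma zsummable_norm g : zsummable g -> zsummable (fun x => `|g x|).
Proof. by apply: zsummable_le => x; rewrite normr_id. Qed.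

Lemma zsummableD f g :
  zsummable f -> zsummable g -> zsummable (fun x => f x + g x).
Proof. exact: integrableD. Qed.

Lemma zsummableB f g :
  zsummable f -> zsummable g -> zsummable (fun x => f x - g x).
Proof. by move=> sf /zsummableN; exact: zsummableD. Qed.

Lemma zsummableZ c g : zsummable g -> zsummable (fun x => c * g x).
Proof. exact: integrableZl. Qed.

Lemma zsumE (A : set int) g : zsum A g = zsum setT (g \_ A).
Proof. exact: Rintegral_mkcond. Qed.

Lemma eq_zsum (A : set int) f g :
  (forall x, A x -> f x = g x) -> zsum A f = zsum A g.
Proof. by move=> fg; apply: eq_Rintegral => x; rewrite inE => /fg. Qed.

Lemma zsumD f g : zsummable f -> zsummable g ->
  zsum setT (fun x => f x + g x) = zsum setT f + zsum setT g.
Proof. exact: RintegralD. Qed.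

Lemma zsumB f g : zsummable f -> zsummable g ->
  zsum setT (fun x => f x - g x) = zsum setT f - zsum setT g.
Proof. exact: RintegralB. Qed.

Lemma zsumZ c g : zsummable g ->
  zsum setT (fun x => c * g x) = c * zsum setT g.
Proof. by move=> sg; exact: RintegralZl. Qed.

Lemma zsum_ge0 g : (forall x, 0 <= g x) -> 0 <= zsum setT g.
Proof. by move=> g0; apply: Rintegral_ge0. Qed.

Lemma le_zsum f g : (forall x, f x <= g x) -> zsummable f -> zsummable g ->
  zsum setT f <= zsum setT g.
Proof. by move=> fg sf sg; apply: le_Rintegral. Qed.

Lemma EFin_zsum g : zsummable g ->
  (zsum setT g)%:E = (\int[@counting int R]_x (g x)%:E)%E.
Proof. by move=> sg; rewrite fineK//; exact: integrable_fin_num. Qed.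

Lemma zsum_gt0 g x : (forall y, 0 <= g y) -> zsummable g -> 0 < g x ->
  0 < zsum setT g.
Proof.
move=> g0 sg gx; apply: lt_le_trans gx _; rewrite -lee_fin EFin_zsum//.
exact: (@counting_integral_ge _ (EFin \o g)).
Qed.

Lemma integral_counting_delta x (c : R) : 0 <= c ->
  (\int[@counting int R]_y ((y == x)%:R * c)%:E)%E = c%:E.
Proof.
move=> c0; rewrite integral_counting_esum; last first.
  by move=> y; rewrite lee_fin mulr_ge0.
rewrite -[RHS](@esum_set1 _ _ x (cst c%:E)) ?lee_fin// [RHS]esum_mkcond.
apply: eq_esum => y _; rewrite in_set1.
by case: eqVneq => _; rewrite ?mul1r ?mul0r.
Qed.

Lemma zsummable_delta x (c : R) : zsummable (fun y => (y == x)%:R * c).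
Proof.
apply/zsummableP; under eq_integral do rewrite normrM normr_nat.
by rewrite integral_counting_delta// ltry.
Qed.

Lemma zsum_delta x (c : R) : zsum setT (fun y => (y == x)%:R * c) = c.
Proof.
have posc (u : R) : 0 <= u -> zsum setT (fun y => (y == x)%:R * u) = u.
  by move=> u0; rewrite /zsum /Rintegral integral_counting_delta.
have [/posc//|/ltW c0] := leP 0 c.
have := posc (- c); rewrite oppr_ge0 => /(_ c0) cE; rewrite -[RHS]opprK -cE.
rewrite -mulN1r -zsumZ; last exact: zsummable_delta.
by apply: eq_zsum => y _; rewrite mulN1r mulrN opprK.
Qed.

(** The iterated integral is finite in the given order, hence in the other; each column sum is a
    single term of the latter and so is finite too. *)
Lemma ge0_zsum_exchange a : (forall x y, 0 <= a x y) ->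
  (forall x, zsummable (a x)) -> zsummable (fun x => zsum setT (a x)) ->
  [/\ forall y, zsummable (a ^~ y), zsummable (fun y => zsum setT (a ^~ y)) &
      zsum setT (fun x => zsum setT (a x)) =
      zsum setT (fun y => zsum setT (a ^~ y))].
Proof.
move=> a0 sa saa.
have aoo : (\int[@counting int R]_y \int[@counting int R]_x (a x y)%:E < +oo)%E.
  rewrite -integral_counting_exchange//.
  move/zsummableP: saa; congr (_ < _)%E; apply: eq_integral => x _.
  by rewrite ger0_norm ?zsum_ge0// EFin_zsum.
have sa' y : zsummable (a ^~ y).
  apply/zsummableP; under eq_integral do rewrite ger0_norm//.
  apply: le_lt_trans aoo.
  apply: (counting_integral_ge (f := fun y => \int[_]_x (a x y)%:E)%E) => z.
  by apply: integral_ge0 => x _; rewrite lee_fin.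
split; first exact: sa'.
  apply/zsummableP; apply: le_lt_trans aoo.
  rewrite le_eqVlt; apply/orP; left; apply/eqP; apply: eq_integral => y _.
  by rewrite ger0_norm ?zsum_ge0// EFin_zsum.
rewrite /zsum/Rintegral; congr fine.
under eq_integral do rewrite (EFin_zsum (sa _)).
under [RHS]eq_integral do rewrite (EFin_zsum (sa' _)).
by rewrite integral_counting_exchange.
Qed.

(** Fubini from the nonnegative case: [a] is the difference of [|a|] and [b = |a| - a], both
    nonnegative, with [b] at most twice [|a|]. *)
Lemma zsum_exchange a : (forall x, zsummable (a x)) ->
  zsummable (fun x => zsum setT (fun y => `|a x y|)) ->
  zsum setT (fun x => zsum setT (a x)) = zsum setT (fun y => zsum setT (a ^~ y)).
Proof.
move=> sa sna; pose b x y := `|a x y| - a x y.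
have sn x : zsummable (fun y => `|a x y|) by exact: zsummable_norm.
have sb x : zsummable (b x) by exact: zsummableB.
have b0 x y : 0 <= b x y by rewrite subr_ge0 ler_norm.
have [snT snaT nE] := ge0_zsum_exchange (fun x y => normr_ge0 (a x y)) sn sna.
have sbx : zsummable (fun x => zsum setT (b x)).
  apply: (zsummable_le _ (zsummableZ 2 sna)) => x.
  rewrite !ger0_norm; first last.
  - by apply: zsum_ge0 => y; exact: b0.
  - by apply: mulr_ge0 => //; apply: zsum_ge0 => y.
  rewrite -zsumZ; last exact: sn.
  apply: le_zsum; [|exact: sb|exact: zsummableZ (sn x)].
  by move=> y; rewrite mulr_natl mulr2n lerD2l -normrN ler_norm.
have [sbT sbaT bE] := ge0_zsum_exchange b0 sb sbx.
have aE x y : a x y = `|a x y| - b x y by rewrite opprB addrC subrK.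
transitivity (zsum setT (fun x => zsum setT (fun y => `|a x y|)) -
              zsum setT (fun x => zsum setT (b x))).
  rewrite -zsumB; [|exact: sna|exact: sbx].
  apply: eq_zsum => x _; rewrite -zsumB; [|exact: sn|exact: sb].
  by apply: eq_zsum => y _; exact: aE.
rewrite nE bE -zsumB; [|exact: snaT|exact: sbaT].
apply: eq_zsum => y _; rewrite -zsumB; [|exact: snT|exact: sbT].
by apply: eq_zsum => x _; rewrite -aE.
Qed.

End zsum_theory.

(** * Discrete convexity *)

(** Convexity by supporting lines, with [d x] a subgradient at [x]. *)
Definition zconvex (R : realType) (h d : int -> R) : Prop :=
  forall x y : int, h x + d x * (y%:~R - x%:~R) <= h y.

Section zconvex_theory.
Context {R : realType}.
Implicit Types (h d L e w : int -> R) (n p q x y : int).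

(** Telescoping: increments to the right of [x] are at least [d x], those to the left at most
    [d x]. *)
Lemma zconvex_increments h d : (forall x, h (x + 1) - h x = d x) ->
  {homo d : x y / x <= y} -> zconvex h d.
Proof.
move=> hd dmon x y.
have up (n : nat) : h x + d x * n%:R <= h (x + n%:Z).
  elim: n => [|n ih]; first by rewrite mulr0 !addr0.
  have := hd (x + n%:Z); rewrite -addrA (_ : n%:Z + 1 = n.+1%:Z); last by lia.
  by have := dmon x (x + n%:Z) ltac:(lia); rewrite -natr1; lra.
have down (n : nat) : h x - d x * n%:R <= h (x - n%:Z).
  elim: n => [|n ih]; first by rewrite mulr0 !subr0.
  have := hd (x - n.+1%:Z); rewrite (_ : x - n.+1%:Z + 1 = x - n%:Z); last by lia.
  by have := dmon (x - n.+1%:Z) x ltac:(lia); rewrite -natr1; lra.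
rewrite -intrB; have [xy|yx] := leP x y.
  have := up `|y - x|%N.
  by rewrite pmulrn gez0_abs ?subr_ge0// subrKC.
have := down `|y - x|%N; rewrite pmulrn -mulrN -intrN.
by rewrite lez0_abs; [rewrite opprK subrKC|rewrite subr_le0 ltW].
Qed.

Lemma zconvex_affineB h d a b :
  zconvex h d -> zconvex (fun x => h x - (a + b * x%:~R)) (fun x => d x - b).
Proof. by move=> hd x y; have := hd x y; lra. Qed.

(** Since [h] drops from [p] to [n], the supporting line at [p] has negative slope; to the left of
    [p] it lies above [h p]. *)
Lemma zconvex_ge0_left h d p n : zconvex h d -> p < n -> 0 <= h p -> h n < 0 ->
  forall x, x <= p -> 0 <= h x.
Proof.
move=> hd pn hp hn x xp; have := hd p n; have := hd p x.
have : p%:~R < n%:~R :> R by rewrite ltr_int.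
have : x%:~R <= p%:~R :> R by rewrite ler_int.
by move=> *; nra.
Qed.

Lemma zconvex_ge0_right h d q n : zconvex h d -> n < q -> 0 <= h q -> h n < 0 ->
  forall x, q <= x -> 0 <= h x.
Proof.
move=> hd nq hq hn x qx; have := hd q n; have := hd q x.
have : n%:~R < q%:~R :> R by rewrite ltr_int.
have : q%:~R <= x%:~R :> R by rewrite ler_int.
by move=> *; nra.
Qed.

(** The difference between [L] and its chord through [p] and [q], multiplied by [q - p] to avoid
    division. *)
Definition secant_gap L p q x : R := (q%:~R - p%:~R) * L x -
  ((q%:~R - x%:~R) * L p + (x%:~R - p%:~R) * L q).

(** The supporting line at [x] is evaluated at [p] and at [q]; with weights [q - x] and [x - p] the
    slope [e x] cancels. The next two lemmas do the same with the line at [p] or [q]. *)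
Lemma secant_gap_le0 L e p q x : zconvex L e -> p <= x -> x <= q ->
  secant_gap L p q x <= 0.
Proof.
move=> Le; rewrite -(ler_int R) -(ler_int R) => px xq.
have := Le x p; have := Le x q; rewrite /secant_gap => Hq Hp.
have := ler_wpM2l (_ : 0 <= q%:~R - x%:~R) Hp; rewrite subr_ge0 => /(_ xq).
have := ler_wpM2l (_ : 0 <= x%:~R - p%:~R) Hq; rewrite subr_ge0 => /(_ px).
by lra.
Qed.

Lemma secant_gap_ge0_left L e p q x : zconvex L e -> p < q -> x <= p ->
  0 <= secant_gap L p q x.
Proof.
move=> Le; rewrite -(ltr_int R) -(ler_int R) => pq xp.
have := Le p x; have := Le p q; rewrite /secant_gap => Hq Hx.
have := ler_wpM2l (_ : 0 <= p%:~R - x%:~R) Hq; rewrite subr_ge0 => /(_ xp).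
have := ler_wpM2l (_ : 0 <= q%:~R - p%:~R) Hx.
rewrite subr_ge0 => /(_ (ltW pq)); lra.
Qed.

Lemma secant_gap_ge0_right L e p q x : zconvex L e -> p < q -> q <= x ->
  0 <= secant_gap L p q x.
Proof.
move=> Le; rewrite -(ltr_int R) -(ler_int R) => pq qx.
have := Le q x; have := Le q p; rewrite /secant_gap => Hp Hx.
have := ler_wpM2l (_ : 0 <= x%:~R - q%:~R) Hp; rewrite subr_ge0 => /(_ qx).
have := ler_wpM2l (_ : 0 <= q%:~R - p%:~R) Hx.
rewrite subr_ge0 => /(_ (ltW pq)); lra.
Qed.

(** The search runs over the offset [k] in [n + k.+1], a natural number, so that a least one
    exists. *)
Lemma first_after (P : pred int) n q : n < q -> P q ->
  exists r, [/\ n < r, P r & forall x, n < x -> x < r -> ~~ P x].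
Proof.
move=> nq Pq; have ex : exists k : nat, P (n + k.+1%:Z).
  exists `|q - n|.-1; rewrite prednK ?absz_gt0 ?subr_eq0 ?gt_eqF//.
  by rewrite gez0_abs ?subr_ge0 ?ltW// subrKC.
case: (ex_minnP ex) => k Pk kmin; exists (n + k.+1%:Z); split => // [|x nx xk].
  by lia.
apply/negP => Px; have : P (n + (`|x - n|.-1).+1%:Z).
  rewrite prednK ?absz_gt0 ?subr_eq0 ?gt_eqF//.
  by rewrite gez0_abs; [rewrite subrKC|rewrite subr_ge0 ltW].
by move=> /kmin; lia.
Qed.

Lemma last_before (P : pred int) n p : p < n -> P p ->
  exists r, [/\ r < n, P r & forall x, r < x -> x < n -> ~~ P x].
Proof.
move=> pn Pp; have [||r [nr Pr rmin]] := @first_after (P \o -%R) (- n) (- p).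
- by rewrite ltrN2.
- by rewrite /= opprK.
exists (- r); split => // [|x rx xn]; first by rewrite ltrNl.
by have := rmin (- x); rewrite /= opprK ltrN2 ltrNl; apply.
Qed.

(* Convex functions orthogonal to the affine ones change sign like + - +, so
   for an affine function l agreeing with L at the two sign changes the product
   (L - l) h is nonnegative. *)
Lemma zconvex_orthogonal h d L e w :
  zconvex h d -> zconvex L e -> (forall x, 0 <= L x) -> (forall x, 0 <= w x) ->
  zsummable (fun x => h x * w x) -> zsummable (fun x => x%:~R * h x * w x) ->
  zsummable (fun x => L x * h x * w x) ->
  zsum setT (fun x => h x * w x) = 0 ->
  zsum setT (fun x => x%:~R * h x * w x) = 0 ->
  0 <= zsum setT (fun x => L x * h x * w x).
Proof.
move=> hd Le L0 w0 sh sxh sLh h0 xh0.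
have affE a b : (fun x => (a + b * x%:~R) * h x * w x) =
    (fun x => a * (h x * w x) + b * (x%:~R * h x * w x)).
  by apply/funext => x; ring.
have s_aff a b : zsummable (fun x => (a + b * x%:~R) * h x * w x).
  by rewrite affE; apply: zsummableD; exact: zsummableZ.
have aff a b : zsum setT (fun x => (a + b * x%:~R) * h x * w x) = 0.
  rewrite affE zsumD; [|exact: zsummableZ|exact: zsummableZ].
  by rewrite zsumZ// zsumZ// h0 xh0 !mulr0 addr0.
(* Either [h] is nonnegative wherever [w] is positive and the sum is termwise nonnegative, or some
   [n] of positive weight has [h n < 0]. *)
have [[n [wn hn]]|hge0] := pselect (exists n, 0 < w n /\ h n < 0); last first.
  apply: zsum_ge0 => x; rewrite -mulrA mulr_ge0//.
  have := w0 x; rewrite le_eqVlt => /predU1P[<-|wx]; first by rewrite mulr0.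
  rewrite mulr_ge0// leNgt; apply/negP => hx; apply: hge0.
  by exists x.
(* An affine function with the sign of [h] everywhere, strictly at [n], would contradict
   orthogonality. This excludes a missing sign change on either side of [n]. *)
have no_aff a b : (forall x, 0 <= (a + b * x%:~R) * h x) ->
    0 < (a + b * n%:~R) * h n -> False.
  move=> ab0 abn.
  suff: 0 < zsum setT (fun x => (a + b * x%:~R) * h x * w x).
    by rewrite aff ltxx.
  apply: (@zsum_gt0 _ _ n) => [x||]; [exact: mulr_ge0|exact: s_aff|].
  exact: mulr_gt0.
have left : (exists p, [/\ p < n, 0 <= h p &
    forall x, p < x -> x < n -> h x < 0]) \/ (forall x, x < n -> h x < 0).
  have [[p [pn hp]]|nop] := pselect (exists p, p < n /\ 0 <= h p).
    left; have [r [rn hr rmax]] := @last_before (fun x => 0 <= h x) n p pn hp.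
    by exists r; split => // x rx xn; rewrite ltNge rmax.
  by right=> x xn; rewrite ltNge; apply/negP => hx; apply: nop; exists x.
have right : (exists q, [/\ n < q, 0 <= h q &
    forall x, n < x -> x < q -> h x < 0]) \/ (forall x, n < x -> h x < 0).
  have [[q [nq hq]]|noq] := pselect (exists q, n < q /\ 0 <= h q).
    left; have [r [nr hr rmin]] := @first_after (fun x => 0 <= h x) n q nq hq.
    by exists r; split => // x nx xr; rewrite ltNge rmin.
  by right=> x nx; rewrite ltNge; apply/negP => hx; apply: noq; exists x.
(* With both sign changes, the chord of [L] through them is subtracted. Otherwise [p - x], [x - q]
   or the constant - 1 has the sign of [h], against [no_aff]. *)
case: left right => [[p [pn hp pmax]]|hl] [[q [nq hq qmin]]|hr].
- have pq : p < q := lt_trans pn nq.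
  have gap0 : 0 <= zsum setT (fun x => secant_gap L p q x * h x * w x).
    apply: zsum_ge0 => x; rewrite mulr_ge0//.
    have [xp|px] := leP x p.
      rewrite mulr_ge0//; first exact: (secant_gap_ge0_left Le).
      exact: (zconvex_ge0_left hd pn hp hn).
    have [qx|xq] := leP q x.
      rewrite mulr_ge0//; first exact: (secant_gap_ge0_right Le).
      exact: (zconvex_ge0_right hd nq hq hn).
    rewrite mulr_le0//; first by apply: (secant_gap_le0 Le); exact: ltW.
    by apply: ltW; case: (ltgtP x n) => [xn|nx|->//]; [exact: pmax|exact: qmin].
  (* The gap is [(q - p) * L] minus an affine function, and the affine part contributes zero. *)
  have := gap0; rewrite (eq_zsum (g := fun x =>
      (q%:~R - p%:~R) * (L x * h x * w x) -
      ((q%:~R * L p - p%:~R * L q) + (L q - L p) * x%:~R) * h x * w x)).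
    rewrite zsumB; [|exact: zsummableZ|exact: s_aff].
    by rewrite aff subr0 zsumZ// pmulr_rge0// subr_gt0 ltr_int.
  by move=> x _; rewrite /secant_gap; ring.
- exfalso; apply: (no_aff p%:~R (- 1)) => [x|].
    rewrite mulN1r; have [xp|px] := leP x p.
      by rewrite mulr_ge0 ?subr_ge0 ?ler_int//; apply: (zconvex_ge0_left hd pn).
    rewrite mulr_le0 ?subr_le0 ?ler_int ?(ltW px)//; apply: ltW.
    by case: (ltgtP x n) => [xn|nx|->//]; [exact: pmax|exact: hr].
  by rewrite mulN1r nmulr_rgt0 ?subr_lt0 ?ltr_int.
- exfalso; apply: (no_aff (- q%:~R) 1) => [x|].
    rewrite mul1r addrC; have [qx|xq] := leP q x.
      by rewrite mulr_ge0 ?subr_ge0 ?ler_int//; apply: (zconvex_ge0_right hd nq).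
    rewrite mulr_le0 ?subr_le0 ?ler_int ?(ltW xq)//; apply: ltW.
    by case: (ltgtP x n) => [xn|nx|->//]; [exact: hl|exact: qmin].
  by rewrite mul1r addrC nmulr_rgt0 ?subr_lt0 ?ltr_int.
- exfalso; apply: (no_aff (- 1) 0) => [x|]; rewrite mul0r addr0 mulN1r.
    by rewrite oppr_ge0 ltW//; case: (ltgtP x n) => [/hl|/hr|->].
  by rewrite oppr_gt0.
Qed.

End zconvex_theory.

(** * Summability from exponential decay *)

Section decay.
Context {R : realType}.
Implicit Types (u : nat -> \bar R) (S : \bar R).

Lemma lt_limn_esup_near u S : (limn_esup u < S)%E ->
  \forall n \near \oo, (u n < S)%E.
Proof.
rewrite /limn_esup limf_esupE => /ereal_inf_lt[_ [V Voo <-] VS].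
apply: filterS Voo => n Vn; apply: le_lt_trans VS.
by apply: ereal_sup_ubound; exists n.
Qed.

Lemma gt_limn_einf_near u S : (S < limn_einf u)%E ->
  \forall n \near \oo, (S < u n)%E.
Proof.
rewrite /limn_einf lteNr => /lt_limn_esup_near.
by apply: filterS => n; rewrite lteN2.
Qed.

Lemma lt_lne (t : R) S : (t%:E < lne S)%E -> ((expR t)%:E < S)%E.
Proof.
case: S => [s| |] /=; [|by move=> _; exact: ltry|by rewrite ltNge leNye].
(* [lne] takes the value [-oo] at nonpositive reals. *)
have [_|s0] := leP s 0; first by rewrite ltNge leNye.
rewrite !lte_fin => ts.
by rewrite -[ltRHS]lnK ?posrE// ltr_expR.
Qed.

Lemma gt_lne (t : R) S : (lne S < t%:E)%E -> (S < (expR t)%:E)%E.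
Proof.
case: S => [s| |] /=; [|by rewrite ltNge leey|by move=> _; exact: ltNyr].
have [s0 _|s0] := leP s 0; first by rewrite lte_fin (le_lt_trans s0)// expR_gt0.
by rewrite !lte_fin => st; rewrite -[ltLHS]lnK ?posrE// ltr_expR.
Qed.

Lemma near_bounded (v : nat -> R) (c : R) : (\forall n \near \oo, v n <= c) ->
  exists C, forall n, v n <= C.
Proof.
move=> [N _ vc]; exists (`|c| + \sum_(i < N) `|v i|) => n.
have [Nn|nN] := leqP N n.
  by rewrite (le_trans (vc n Nn))// (le_trans (ler_norm _))// lerDl sumr_ge0.
rewrite (bigD1 (Ordinal nN))//= addrCA (le_trans (ler_norm _))// lerDl.
by rewrite addr_ge0// sumr_ge0.
Qed.

(** A geometric series of ratio [expR (- s)], which is less than 1. *)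
Lemma esum_expR_lty (s : R) : 0 < s ->
  (\esum_(n in [set: nat]) (expR (- (s * n%:R)))%:E < +oo)%E.
Proof.
move=> s0; rewrite -nneseries_esumT; last by move=> n; rewrite lee_fin expR_ge0.
set z := expR (- s).
rewrite (eq_eseriesr (g := fun n => (geometric 1 z n)%:E)); last first.
  by move=> n _; rewrite /geometric/= mul1r -expRM_natr mulNr.
have z1 : `|z| < 1 by rewrite ger0_norm ?expR_ge0// -expR0 ltr_expR oppr_lt0.
have zcvg : (fun n => (series (geometric 1 z) n)%:E) @ \oo -->
    (1 * (1 - z)^-1)%:E.
  by apply: cvg_EFin; [exact: nearW|exact: cvg_geometric_series].
rewrite (_ : (\sum_(0 <= i <oo) _)%E = (1 * (1 - z)^-1)%:E) ?ltry//.
apply: cvg_lim => //; apply: cvg_trans zcvg; apply: near_eq_cvg.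
by apply: nearW => n; rewrite /series/= sumEFin.
Qed.

Lemma zsummable_expR (s : R) : 0 < s ->
  zsummable (fun x => expR (- (s * `|x|%N%:R))).
Proof.
move=> s0; apply/zsummableP.
under eq_integral do rewrite ger0_norm ?expR_ge0//.
have e0 (x : int) : (0 <= (expR (- (s * `|x|%N%:R)))%:E :> \bar R)%E.
  by rewrite lee_fin expR_ge0.
rewrite integral_counting_esum// (esumID (range Posz))// !setTI.
rewrite esum_image; last by move=> i j _ _ [].
apply: lte_add_pinfty; first exact: esum_expR_lty.
have -> : ~` range Posz = range Negz.
  apply/seteqP; split => [[n|n]|_ [n _ <-] [m _]]//=.
  - by case; exists n.
  - by exists n.
rewrite esum_image; last by move=> i j _ _ [].
(* [Negz n] has absolute value [n + 1], so its term is at most the term of index [n]. *)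
apply: le_lt_trans (esum_expR_lty s0); apply: le_esum => n _.
by rewrite lee_fin ler_expR lerN2 ler_pM2l// ler_nat.
Qed.

(** With [u = t * n], one has [1 + u ^+ 2 <= (1 + u) ^+ 2 <= expR (2 * u)]; the constant [1 + t^-2]
    absorbs the rescaling from [n] to [u]. *)
Lemma expR_quad (t : R) : 0 < t ->
  exists K, forall n : nat, 1 + n%:R ^+ 2 <= K * expR (2 * t * n%:R).
Proof.
move=> t0; exists (1 + (t ^+ 2)^-1) => n.
have t20 : 0 < t ^+ 2 by rewrite exprn_gt0.
have i0 : 0 <= (t ^+ 2)^-1 by rewrite invr_ge0 ltW.
have n20 : 0 <= n%:R ^+ 2 :> R by rewrite sqr_ge0.
apply: (@le_trans _ _ ((1 + (t ^+ 2)^-1) * (1 + t ^+ 2 * n%:R ^+ 2))).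
  rewrite mulrDl mul1r mulrDr mulr1 mulKf ?gt_eqF//.
  have : 0 <= t ^+ 2 * n%:R ^+ 2 by rewrite mulr_ge0// ltW.
  by lra.
apply: ler_wpM2l; first by rewrite addr_ge0.
have tn : 0 <= t * n%:R by rewrite mulr_ge0// ltW.
have -> : 2 * t * n%:R = t * n%:R + t * n%:R by ring.
rewrite expRD; have e1 := expR_ge1Dx (t * n%:R).
rewrite -exprMn; set u := t * n%:R; rewrite -/u in tn e1 *.
by nra.
Qed.

Lemma zsummable_decay (w : int -> R) (s1 s2 C1 C2 : R) :
  (forall x, 0 <= w x) -> 0 < s1 -> 0 < s2 ->
  (forall n : nat, w n%:Z <= C1 * expR (- (s1 * n%:R))) ->
  (forall n : nat, w (- n%:Z) <= C2 * expR (- (s2 * n%:R))) ->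
  zsummable (fun x => (1 + x%:~R ^+ 2) * w x).
Proof.
move=> w0 s10 s20 wpos wneg.
(* By [expR_quad] the quadratic factor costs the rate [2 * t = s / 2], which leaves decay at rate
   [s / 2]. *)
pose s := Num.min s1 s2; pose t := s / 4; pose C := Num.max C1 C2.
have s0 : 0 < s by rewrite lt_min s10.
have t0 : 0 < t by rewrite divr_gt0.
have C0 : 0 <= C.
  rewrite le_max; apply/orP; left; have := wpos 0%N.
  by rewrite mulr0 oppr0 expR0 mulr1; exact: le_trans.
have wC x : w x <= C * expR (- (s * `|x|%N%:R)).
  have [n [xn [sn|sn]]] : exists n, `|x|%N = n /\ (x = n%:Z \/ x = - n%:Z).
  - by exists `|x|%N; split => //; lia.
  - rewrite xn sn; apply: le_trans (wpos n) _; apply: ler_pM => //.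
    + by have := wpos 0%N; rewrite mulr0 oppr0 expR0 mulr1; exact: le_trans.
    + by rewrite le_max lexx.
    + by rewrite ler_expR lerN2 ler_wpM2r// ge_min lexx.
  - rewrite xn sn; apply: le_trans (wneg n) _; apply: ler_pM => //.
    + by have := wneg 0%N; rewrite mulr0 [in expR _]oppr0 expR0 mulr1; exact: le_trans.
    + by rewrite le_max lexx orbT.
    + by rewrite ler_expR lerN2 ler_wpM2r// ge_min lexx orbT.
have [K KE] := expR_quad t0.
apply: zsummable_le (zsummableZ (K * C) (zsummable_expR (s := s / 2) _)) => [x|].
  have x0 : 0 <= 1 + x%:~R ^+ 2 :> R by rewrite addr_ge0// sqr_ge0.
  rewrite ger0_norm ?mulr_ge0//; apply: le_trans (ler_norm _).
  have := KE `|x|%N.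
  have -> : (`|x|%N%:R ^+ 2 = x%:~R ^+ 2 :> R).
    by rewrite natr_absz intr_norm real_normK ?num_real.
  move=> Kx; apply: le_trans (ler_pM x0 (w0 x) Kx (wC x)) _.
  rewrite mulrACA -expRD le_eqVlt; apply/orP; left; apply/eqP.
  by congr (_ * expR _); rewrite /t; field.
by rewrite divr_gt0.
Qed.

End decay.

(** * Discrete primitives *)

Section step_kernel.
Context {R : realType}.
Implicit Types (g phi : int -> R) (x y : int).

(* Subtracting (y < 0) makes the sums over y finite; it does not change the sum
   over x against (x - mean) p x, which vanishes on constants. *)
Definition step_kernel x y : R := (y < x)%R%:R - (y < 0)%R%:R.

Lemma int_stepP (P : int -> Prop) : P 0 -> (forall x, P x <-> P (x + 1)) ->
  forall x, P x.
Proof.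
move=> P0 PS x; have [n [->|->]] : exists n : nat, x = n%:Z \/ x = - n%:Z.
- by exists `|x|%N; lia.
- by elim: n => // n /PS; rewrite -PoszD addn1.
- elim: n => [|n IH]; first by rewrite oppr0.
  by apply/PS; rewrite (_ : _ + 1 = - n%:Z)//; lia.
Qed.

Lemma step_kernel0 y : step_kernel 0 y = 0.
Proof. by rewrite /step_kernel subrr. Qed.

Lemma step_kernelS x y : step_kernel (x + 1) y = step_kernel x y + (y == x)%:R.
Proof.
rewrite /step_kernel addrAC; congr (_ - _); rewrite ltzD1 le_eqVlt.
by case: ltgtP => _ /=; rewrite ?addr0 ?add0r.
Qed.

(** For fixed [x] the kernel has finite support in [y]; two-sided induction on [x] adds or removes
    one point at a time. *)
Lemma zsummable_step_kernel g x : zsummable (fun y => step_kernel x y * g y).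
Proof.
have dE (z : int) : (fun y => (y == z)%:R * g y) = (fun y => (y == z)%:R * g z).
  by apply/funext => y; case: eqVneq => [->//|_]; rewrite !mul0r.
have sd (z : int) : zsummable (fun y => (y == z)%:R * g y).
  by rewrite dE; exact: zsummable_delta.
elim/int_stepP: x => [|x].
  rewrite (_ : (fun y => _) = fun=> 0); first exact: integrable0.
  by apply/funext => y; rewrite step_kernel0 mul0r.
have KS : (fun y => step_kernel (x + 1) y * g y) =
    (fun y => step_kernel x y * g y + (y == x)%:R * g y).
  by apply/funext => y; rewrite step_kernelS mulrDl.
split=> [sx|]; first by rewrite KS; apply: zsummableD.
have -> : (fun y => step_kernel x y * g y) =
    (fun y => step_kernel (x + 1) y * g y - (y == x)%:R * g y).
  by apply/funext => y; rewrite step_kernelS; ring.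
by move=> sx; apply: zsummableB.
Qed.

Lemma zsummable_norm_step_kernel x : zsummable (fun y => `|step_kernel x y|).
Proof.
apply: zsummable_norm.
rewrite (_ : step_kernel x = fun y => step_kernel x y * 1).
  exact: zsummable_step_kernel.
by apply/funext => y; rewrite mulr1.
Qed.

(** The primitive vanishing at 0: the sum of [phi] over [0 <= y < x], or minus the sum over
    [x <= y < 0] when [x] is negative. *)
Definition step_primitive phi x : R :=
  zsum setT (fun y => step_kernel x y * phi y).

Lemma step_primitiveS phi x :
  step_primitive phi (x + 1) - step_primitive phi x = phi x.
Proof.
rewrite /step_primitive -zsumB; [|exact: zsummable_step_kernel..].
rewrite -[RHS](zsum_delta x); apply: eq_zsum => y _; rewrite step_kernelS.
by case: eqVneq => [->|_] /=; ring.
Qed.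

(** The sum vanishes at 0, and each unit step away from 0 changes the kernel at one point by 1. *)
Lemma zsum_norm_step_kernel x :
  zsum setT (fun y => `|step_kernel x y|) <= `|x%:~R|.
Proof.
have sK := zsummable_norm_step_kernel.
have sK1 z w : zsummable (fun y => `|step_kernel z y| + (y == w)%:R * 1).
  by apply: zsummableD => //; exact: zsummable_delta.
have le1 z w v :
    (forall y, `|step_kernel z y| <= `|step_kernel w y| + (y == v)%:R) ->
    zsum setT (fun y => `|step_kernel z y|) <=
    zsum setT (fun y => `|step_kernel w y|) + 1.
  move=> zw; rewrite -(zsum_delta v 1) -zsumD; [|exact: sK|exact: zsummable_delta].
  apply: le_zsum; [|exact: sK|exact: sK1].
  by move=> y; rewrite mulr1.
have up z : zsum setT (fun y => `|step_kernel (z + 1) y|) <=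
    zsum setT (fun y => `|step_kernel z y|) + 1.
  apply: (le1 _ _ z) => y; rewrite step_kernelS.
  by rewrite (le_trans (ler_normD _ _))// normr_nat.
have down z : zsum setT (fun y => `|step_kernel z y|) <=
    zsum setT (fun y => `|step_kernel (z + 1) y|) + 1.
  apply: (le1 _ _ z) => y; rewrite step_kernelS.
  by rewrite -[leLHS](normr_id) -{1}(addrK (y == z)%:R (step_kernel z y))
    normr_id (le_trans (ler_normB _ _))// normr_nat.
have K0 : zsum setT (fun y => `|step_kernel 0 y|) = 0.
  rewrite (eq_zsum (g := fun=> 0)); last by move=> y _; rewrite step_kernel0 normr0.
  by rewrite /zsum Rintegral_cst// mul0r.
have [n [->|->]] : exists n : nat, x = n%:Z \/ x = - n%:Z.
- by exists `|x|%N; lia.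
- rewrite ger0_norm ?ler0z//; elim: n => [|n IH]; first by rewrite K0.
  have := up n%:Z; rewrite -PoszD addn1 -[n.+1%:~R]natr1 => /le_trans; apply.
  by rewrite lerD2r.
- rewrite mulrNz normrN ger0_norm ?ler0z//.
  elim: n => [|n IH]; first by rewrite oppr0 K0.
  have := down (- n.+1%:Z); rewrite (_ : _ + 1 = - n%:Z); last by lia.
  by rewrite -[n.+1%:~R]natr1 => /le_trans; apply; rewrite lerD2r.
Qed.

(** Stated with the absolute value inside the sum, as the domination for an exchange of sums in
    [zsum_nu]. *)
Lemma step_primitive_bound phi (C : R) x : (forall y, `|phi y| <= C) ->
  zsum setT (fun y => `|step_kernel x y * phi y|) <= C * `|x%:~R|.
Proof.
move=> phiC; have C0 : 0 <= C := le_trans (normr_ge0 _) (phiC 0).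
have sK := zsummable_norm_step_kernel x.
apply: (@le_trans _ _ (C * zsum setT (fun y => `|step_kernel x y|))).
  rewrite -zsumZ//; apply: le_zsum => [y||].
  - by rewrite normrM mulrC ler_wpM2r.
  - by apply: zsummable_norm; exact: zsummable_step_kernel.
  - exact: zsummableZ.
by rewrite ler_wpM2l// zsum_norm_step_kernel.
Qed.

Lemma norm_step_primitive phi (C : R) x : (forall y, `|phi y| <= C) ->
  `|step_primitive phi x| <= C * `|x%:~R|.
Proof.
move=> phiC; apply: le_trans (step_primitive_bound x phiC).
apply: (@le_normr_Rintegral _ _ _ (@counting int R) setT) => //.
exact: zsummable_step_kernel.
Qed.

Lemma zconvex_step_primitive phi :
  {homo phi : x y / x <= y} -> zconvex (step_primitive phi) phi.
Proof. by apply: zconvex_increments => x; exact: step_primitiveS. Qed.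

End step_kernel.

(** * Regression of a convex function *)

Section regression.
Context {R : realType}.
Implicit Types (Phi d L e u w p q : int -> R).

(** The weight [1 + x ^+ 2] dominates every integrand of at most quadratic growth, so [second_order]
    records just this one summability. *)
Lemma zsummable_quad u w (C : R) : zsummable (fun x => (1 + x%:~R ^+ 2) * w x) ->
  (forall x, `|u x| <= C * (1 + x%:~R ^+ 2)) -> zsummable (fun x => u x * w x).
Proof.
move=> sw uC; apply: zsummable_le (zsummableZ C sw) => x.
have q0 : 0 <= 1 + x%:~R ^+ 2 :> R by rewrite addr_ge0// sqr_ge0.
have C0 : 0 <= C.
  by have := le_trans (normr_ge0 _) (uC 0); rewrite mulr0z expr0n addr0 mulr1.
rewrite mulrA !normrM; apply: ler_wpM2r => //.
by rewrite -normrM [leRHS]ger0_norm ?mulr_ge0.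
Qed.

Lemma zsummable_quad1 w : zsummable (fun x => (1 + x%:~R ^+ 2) * w x) ->
  zsummable w.
Proof.
move=> sw; rewrite (_ : w = fun x => 1 * w x).
  apply: (zsummable_quad (C := 1) sw) => x.
  by rewrite normr1 mul1r lerDl sqr_ge0.
by apply/funext => x; rewrite mul1r.
Qed.

Definition second_order p : Prop :=
  [/\ forall x, 0 <= p x, zsummable (fun x => (1 + x%:~R ^+ 2) * p x)
    & zsum setT p = 1].

Definition mean p : R := zsum setT (fun x => x%:~R * p x).

Definition var p : R := zsum setT (fun x => (x%:~R - mean p) ^+ 2 * p x).

(** Only [x] is centred: centring [Phi] as well would subtract a multiple of the sum in [meanB_eq0],
    which is zero. *)
Definition cov p Phi : R :=
  zsum setT (fun x => Phi x * ((x%:~R - mean p) * p x)).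

Section moments.
Variables (p : int -> R) (Phi : int -> R) (C : R).
Hypotheses (p2 : second_order p) (PhiC : forall x, `|Phi x| <= C * `|x%:~R|).

Let sp : zsummable (fun x => (1 + x%:~R ^+ 2) * p x).
Proof. by case: p2. Qed.

Let C0 : 0 <= C.
Proof. by have := le_trans (normr_ge0 _) (PhiC 1); rewrite mulr1z normr1 mulr1. Qed.

Let abs_le (x : int) : `|x%:~R| <= 1 + x%:~R ^+ 2 :> R.
Proof.
rewrite -[_ ^+ 2](@real_normK _ _ (num_real _)).
by set u := `|_|; have u0 : 0 <= u := normr_ge0 _; nra.
Qed.

Lemma zsummable_weight : zsummable p.
Proof. exact: zsummable_quad1 sp. Qed.

Lemma zsummable_id : zsummable (fun x => x%:~R * p x).
Proof. by apply: (zsummable_quad (C := 1) sp) => x; rewrite mul1r. Qed.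

Lemma zsummable_sq : zsummable (fun x => x%:~R ^+ 2 * p x).
Proof.
apply: (zsummable_quad (C := 1) sp) => x.
by rewrite mul1r ger0_norm ?sqr_ge0// lerDr.
Qed.

Lemma zsummable_sqB (c : R) : zsummable (fun x => (x%:~R - c) ^+ 2 * p x).
Proof.
rewrite (_ : (fun x => _) = fun x => x%:~R ^+ 2 * p x +
    (- (2 * c) * (x%:~R * p x) + c ^+ 2 * p x)); last first.
  by apply/funext => x; ring.
apply: zsummableD; [exact: zsummable_sq|apply: zsummableD].
- exact/zsummableZ/zsummable_id.
- exact/zsummableZ/zsummable_weight.
Qed.

Lemma zsummable_idB (c : R) : zsummable (fun x => (x%:~R - c) * p x).
Proof.
rewrite (_ : (fun x => _) = fun x => x%:~R * p x - c * p x); last first.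
  by apply/funext => x; rewrite mulrBl.
by apply: zsummableB; [exact: zsummable_id|exact/zsummableZ/zsummable_weight].
Qed.

Lemma zsummable_fun : zsummable (fun x => Phi x * p x).
Proof.
apply: (zsummable_quad (C := C) sp) => x.
by rewrite (le_trans (PhiC x))// ler_wpM2l.
Qed.

Lemma zsummable_idM : zsummable (fun x => x%:~R * Phi x * p x).
Proof.
apply: (zsummable_quad (C := C) sp) => x; rewrite normrM.
apply: (@le_trans _ _ (`|x%:~R| * (C * `|x%:~R|))); first by rewrite ler_wpM2l.
by rewrite mulrCA -expr2 real_normK ?num_real// ler_wpM2l// lerDr.
Qed.

Lemma meanB_eq0 : zsum setT (fun x => (x%:~R - mean p) * p x) = 0.
Proof.
rewrite (eq_zsum (g := fun x => x%:~R * p x - mean p * p x)); last first.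
  by move=> x _; rewrite mulrBl.
rewrite zsumB; [|exact: zsummable_id|exact/zsummableZ/zsummable_weight].
rewrite zsumZ; last exact: zsummable_weight.
by case: p2 => _ _ ->; rewrite mulr1 subrr.
Qed.

Lemma varE : var p = zsum setT (fun x => x%:~R ^+ 2 * p x) - mean p ^+ 2.
Proof.
(* The square is split so that one term is a multiple of the centred variable, whose sum
   vanishes. *)
rewrite /var (eq_zsum (g := fun x => x%:~R ^+ 2 * p x -
    (mean p * (x%:~R * p x) + mean p * ((x%:~R - mean p) * p x)))); last first.
  by move=> x _; ring.
have s1 : zsummable (fun x => mean p * (x%:~R * p x)).
  exact/zsummableZ/zsummable_id.
have sB := zsummable_idB (mean p).
rewrite zsumB; [|exact: zsummable_sq|exact: (zsummableD s1 (zsummableZ _ sB))].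
rewrite zsumD; [|exact: s1|exact: zsummableZ].
rewrite (zsumZ _ zsummable_id) (zsumZ _ sB) meanB_eq0 -/(mean p).
by rewrite mulr0 addr0 expr2.
Qed.

Lemma zsummable_cov : zsummable (fun x => Phi x * ((x%:~R - mean p) * p x)).
Proof.
rewrite (_ : (fun x => _) = fun x => x%:~R * Phi x * p x -
    mean p * (Phi x * p x)); last by apply/funext => x; ring.
by apply: zsummableB; [exact: zsummable_idM|exact/zsummableZ/zsummable_fun].
Qed.

Lemma covE : cov p Phi = zsum setT (fun x => x%:~R * Phi x * p x) -
  mean p * zsum setT (fun x => Phi x * p x).
Proof.
rewrite /cov (eq_zsum (g := fun x => x%:~R * Phi x * p x -
    mean p * (Phi x * p x))); last by move=> x _; ring.
rewrite zsumB; [|exact: zsummable_idM|exact/zsummableZ/zsummable_fun].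
by rewrite (zsumZ _ zsummable_fun).
Qed.

Lemma zsummable_residual a b :
  zsummable (fun x => (Phi x - (a + b * x%:~R)) * p x).
Proof.
rewrite (_ : (fun x => _) =
    fun x => Phi x * p x - (a * p x + b * (x%:~R * p x))); last first.
  by apply/funext => x; ring.
apply: zsummableB; [exact: zsummable_fun|apply: zsummableD].
- exact/zsummableZ/zsummable_weight.
- exact/zsummableZ/zsummable_id.
Qed.

(** Together with [zsum_id_residual] this yields the normal equations: both sums vanish at the least
    squares coefficients. *)
Lemma zsum_residual a b :
  zsum setT (fun x => (Phi x - (a + b * x%:~R)) * p x) =
  zsum setT (fun x => Phi x * p x) - (a + b * mean p).
Proof.
have sa : zsummable (fun x => a * p x) by exact/zsummableZ/zsummable_weight.
have sb : zsummable (fun x => b * (x%:~R * p x)).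
  exact/zsummableZ/zsummable_id.
rewrite (eq_zsum (g := fun x => Phi x * p x - (a * p x + b * (x%:~R * p x)))).
  rewrite zsumB; [|exact: zsummable_fun|exact: zsummableD].
  rewrite zsumD; [|exact: sa|exact: sb].
  rewrite (zsumZ _ zsummable_weight) (zsumZ _ zsummable_id).
  by case: p2 => _ _ ->; rewrite mulr1.
by move=> x _; ring.
Qed.

Lemma zsummable_id_residual a b :
  zsummable (fun x => x%:~R * (Phi x - (a + b * x%:~R)) * p x).
Proof.
rewrite (_ : (fun x => _) = fun x => x%:~R * Phi x * p x -
    (a * (x%:~R * p x) + b * (x%:~R ^+ 2 * p x))); last first.
  by apply/funext => x; ring.
apply: zsummableB; [exact: zsummable_idM|apply: zsummableD].
- exact/zsummableZ/zsummable_id.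
- exact/zsummableZ/zsummable_sq.
Qed.

Lemma zsum_id_residual a b :
  zsum setT (fun x => x%:~R * (Phi x - (a + b * x%:~R)) * p x) =
  cov p Phi + mean p * zsum setT (fun x => Phi x * p x) -
  (a * mean p + b * (var p + mean p ^+ 2)).
Proof.
have sa : zsummable (fun x => a * (x%:~R * p x)).
  exact/zsummableZ/zsummable_id.
have sb : zsummable (fun x => b * (x%:~R ^+ 2 * p x)).
  exact/zsummableZ/zsummable_sq.
rewrite (eq_zsum (g := fun x => x%:~R * Phi x * p x -
    (a * (x%:~R * p x) + b * (x%:~R ^+ 2 * p x)))); last by move=> x _; ring.
rewrite zsumB; [|exact: zsummable_idM|exact: zsummableD].
rewrite zsumD; [|exact: sa|exact: sb].
rewrite (zsumZ _ zsummable_id) (zsumZ _ zsummable_sq) -/(mean p).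
by rewrite covE varE !subrK.
Qed.

End moments.

Lemma regression_le_expectation Phi d L e C p q :
  second_order p -> second_order q -> (forall x, `|Phi x| <= C * `|x%:~R|) ->
  0 < var p -> zconvex Phi d -> zconvex L e -> (forall x, 0 <= L x) ->
  (forall x, q x = L x * p x) ->
  zsum setT (fun x => Phi x * p x) + cov p Phi / var p * (mean q - mean p) <=
  zsum setT (fun x => Phi x * q x).
Proof.
move=> p2 q2 PhiC v0 Phid Le L0 qE.
(* Slope and intercept of the regression line, which passes through the mean of [p] at height
   [E_p Phi]; [h] is the residual. *)
pose b := cov p Phi / var p.
pose a := zsum setT (fun x => Phi x * p x) - b * mean p.
pose h x := Phi x - (a + b * x%:~R).
have LhE : (fun x => L x * h x * p x) = (fun x => h x * q x).
  by apply/funext => x; rewrite qE; ring.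
have : 0 <= zsum setT (fun x => L x * h x * p x).
  apply: (zconvex_orthogonal (h := h) (d := fun x => d x - b) (e := e)) => //.
  - exact: zconvex_affineB.
  - by case: p2.
  - exact: (zsummable_residual p2 PhiC).
  - exact: (zsummable_id_residual p2 PhiC).
  - by rewrite LhE; exact: (zsummable_residual q2 PhiC).
  - by rewrite (zsum_residual p2 PhiC) /a; ring.
  - by rewrite (zsum_id_residual p2 PhiC) /a /b; field; rewrite gt_eqF.
by rewrite LhE (zsum_residual q2 PhiC) /a -/b; lra.
Qed.

(** Adding the two regression inequalities cancels the expectations of [Phi] and leaves the
    difference of slopes times [mean q - mean p], a positive factor. Both densities [L] and [L']
    must be convex since [p] and [q] exchange roles. *)
Lemma slope_monotone Phi d L e L' e' C p q :
  second_order p -> second_order q -> (forall x, `|Phi x| <= C * `|x%:~R|) ->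
  0 < var p -> 0 < var q -> zconvex Phi d ->
  zconvex L e -> (forall x, 0 <= L x) -> (forall x, q x = L x * p x) ->
  zconvex L' e' -> (forall x, 0 <= L' x) -> (forall x, p x = L' x * q x) ->
  mean p < mean q -> cov p Phi / var p <= cov q Phi / var q.
Proof.
move=> p2 q2 PhiC vp vq Phid Le L0 qE Le' L0' pE pq.
have := regression_le_expectation p2 q2 PhiC vp Phid Le L0 qE.
have := regression_le_expectation q2 p2 PhiC vq Phid Le' L0' pE.
by move=> H1 H2; rewrite -(ler_pM2r (x := mean q - mean p)) ?subr_gt0//; lra.
Qed.

End regression.

(** * The exponential family *)

Lemma lt_real_lt_ereal (R : realType) (a : R) (S : \bar R) :
  (a%:E < S)%E -> exists t : R, a < t /\ (t%:E < S)%E.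
Proof.
case: S => [s|_|]; last by rewrite ltNge leNye.
- by rewrite lte_fin => as_; exists ((a + s) / 2); rewrite lte_fin; lra.
- by exists (a + 1); rewrite ltrDl ltry.
Qed.

Lemma ereal_lt_real_lt (R : realType) (a : R) (S : \bar R) :
  (S < a%:E)%E -> exists t : R, t < a /\ (S < t%:E)%E.
Proof.
rewrite -lteN2 => /lt_real_lt_ereal[t [at_ tS]]; exists (- t).
by rewrite EFinN lteNr ltrNl.
Qed.

(** [w] is the density of [m] with respect to counting measure; positive and negative parts of [u]
    are treated separately, as [integral_esum] requires nonnegativity. *)
Lemma integral_zsum_density (R : realType) (m : {measure set int -> \bar R})
    (u w : int -> R) : (forall x, 0 <= w x) ->
  (forall x, m [set x] = (w x)%:E) -> zsummable (fun x => u x * w x) ->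
  (\int[m]_x (u x)%:E = (zsum setT (fun x => u x * w x))%:E)%E.
Proof.
move=> w0 mE suw; rewrite EFin_zsum// integralE [RHS]integralE.
rewrite !integral_esum//; congr (_ - _)%E; apply: eq_esum => x _.
- rewrite !funeposE mE /= counting_set1 mule1 -!EFin_max -EFinM.
  by rewrite maxr_pMl// mul0r.
- rewrite !funenegE mE /= counting_set1 mule1 -!EFin_max -EFinM.
  by rewrite maxr_pMl// mul0r mulNr.
Qed.

Lemma zconvex_expR (R : realType) (c k : R) : 0 <= c ->
  exists e, zconvex (fun x : int => c * expR (k * x%:~R)) e.
Proof.
move=> c0; exists (fun x : int => c * expR (k * x%:~R) * (expR k - 1)).
apply: zconvex_increments => [x|x y xy].
  by rewrite intrD mulr1z mulrDr mulr1 expRD; ring.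
(* The increments are the exponential times [expR k - 1]: an increasing function with a nonnegative
   factor, or a decreasing one with a nonpositive factor. *)
have [k0|k0] := leP 0 k.
- apply: ler_wpM2r; first by rewrite subr_ge0 -expR0 ler_expR.
  by rewrite ler_wpM2l// ler_expR ler_wpM2l// ler_int.
- apply: ler_wnM2r; first by rewrite subr_le0 -expR0 ler_expR ltW.
  by rewrite ler_wpM2l// ler_expR ler_wnM2l ?ler_int// ltW.
Qed.

Section exponential_family.
Context {R : realType} {xmin xmax : \bar int} {f : int -> {nonneg R}}.
Hypotheses (xmin_le0 : (xmin <= 0)%E) (xmax_ge1 : (1 <= xmax)%E).
Hypothesis f_gt0 : forall x : int, int_interval xmin xmax x ->
  (xmin < x%:E)%E -> 0 < (f x)%:num.

Local Notation I := (int_interval xmin xmax).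
Local Notation dom := (theta_dom xmin xmax f).

(** * Unnormalised weights and their tails *)

Lemma int_intervalE (x : int) : I x <-> (xmin <= x%:E)%E /\ (x%:E <= xmax)%E.
Proof.
have -> : (xmin <= x%:E)%E = (xmin - 1 < x%:E)%E.
  case: xmin => [m| |] //=.
  by rewrite -EFinB lte_fin lee_fin ltrBlDr ltzD1.
have -> : (x%:E <= xmax)%E = (x%:E < xmax + 1)%E.
  case: xmax => [m| |] //=.
  by rewrite -EFinD lte_fin lee_fin ltzD1.
by [].
Qed.

Lemma int_interval0 : I 0.
Proof. by apply/int_intervalE; split => //; exact: le_trans xmax_ge1. Qed.

Lemma int_interval1 : I 1.
Proof. by apply/int_intervalE; split => //; exact: le_trans xmin_le0 _. Qed.

(** Extended by zero off [I], so that all sums run over [int]. *)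
Definition gibbs (theta : R) : int -> R :=
  (fun x => expR (theta * x%:~R) / ffact f x) \_ I.

Lemma gibbsE theta x : I x -> gibbs theta x = expR (theta * x%:~R) / ffact f x.
Proof. by move=> Ix; rewrite /gibbs patchT// inE. Qed.

Lemma gibbs_out theta x : ~ I x -> gibbs theta x = 0.
Proof. by move=> Ix; rewrite /gibbs patchC// inE. Qed.

Lemma gibbs_ge0 theta x : 0 <= gibbs theta x.
Proof.
by rewrite /gibbs patchE; case: ifP => // _; rewrite divr_ge0 ?expR_ge0 ?ffact_ge0.
Qed.

Lemma gibbs_le theta x : gibbs theta x <= expR (theta * x%:~R) / ffact f x.
Proof.
by rewrite /gibbs patchE; case: ifP => // _; rewrite divr_ge0 ?expR_ge0 ?ffact_ge0.
Qed.

Lemma gibbs_tilt theta theta' x :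
  gibbs theta' x = expR ((theta' - theta) * x%:~R) * gibbs theta x.
Proof.
have [Ix|Ix] := pselect (I x); last by rewrite !gibbs_out// mulr0.
by rewrite !gibbsE// mulrA -expRD -mulrDl subrK.
Qed.

Lemma gibbs_gt0 theta x : x = 0 \/ x = 1 -> 0 < gibbs theta x.
Proof.
case=> ->.
  rewrite gibbsE ?divr_gt0 ?expR_gt0//; last exact: int_interval0.
  by rewrite /ffact big_geq.
rewrite gibbsE ?divr_gt0 ?expR_gt0//; last exact: int_interval1.
rewrite /ffact big_nat1; apply: f_gt0; first exact: int_interval1.
by apply: le_lt_trans xmin_le0 _.
Qed.

(** For infinite [xmax], choose [t] between [theta] and [theta_sup]: eventually [ffact f n] is at
    least [expR (t * n)], which leaves decay at rate [t - theta]. For finite [xmax] the weights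
    eventually vanish. *)
Lemma gibbs_tail_pos theta : dom theta ->
  exists s C, 0 < s /\
    forall n : nat, gibbs theta n%:Z <= C * expR (- (s * n%:R)).
Proof.
move=> [_ thetaS].
suff [s [s0 near1]] : exists s, 0 < s /\
    \forall n \near \oo, gibbs theta n%:Z * expR (s * n%:R) <= 1.
  (* The finitely many remaining terms only enlarge the constant. *)
  have [C CE] := near_bounded near1; exists s, C; split => // n.
  by rewrite expRN ler_pdivlMr ?expR_gt0.
case xmaxE: xmax => [m| |].
- exists 1; split => //; near=> n.
  rewrite gibbs_out ?mul0r// => /int_intervalE[_]; rewrite xmaxE lee_fin.
  apply/negP; rewrite -ltNge; apply: (@le_lt_trans _ _ `|m|%N%:Z); first by lia.
  by rewrite ltz_nat; near: n; exact: nbhs_infty_gt.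
- move: thetaS; rewrite /theta_sup xmaxE eqxx => /lt_real_lt_ereal[t [tt tS]].
  exists (t - theta); split; first by rewrite subr_gt0.
  move: tS => /lt_lne/gt_limn_einf_near nearS; near=> n.
  have n0 : (0 < n)%N by near: n; exact: nbhs_infty_gt.
  have : ((expR t)%:E < (ffact f n%:Z `^ n%:R^-1)%:E)%E by near: n.
  rewrite lte_fin => tn; have F : expR (t * n%:R) <= ffact f n%:Z.
    have -> : ffact f n%:Z = (ffact f n%:Z `^ n%:R^-1) ^+ n.
      rewrite -powR_mulrn ?powR_ge0// -powRrM mulVf ?pnatr_eq0 -?lt0n//.
      by rewrite powRr1 ?ffact_ge0.
    rewrite expRM_natr.
    by rewrite lerXn2r ?nnegrE ?expR_ge0 ?powR_ge0// ltW.
  apply: (@le_trans _ _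
      (expR (theta * n%:R) / ffact f n%:Z * expR ((t - theta) * n%:R))).
    by rewrite ler_wpM2r ?expR_ge0//; exact: gibbs_le.
  rewrite mulrAC -expRD -mulrDl addrC subrK ler_pdivrMr ?mul1r//.
  exact: lt_le_trans (expR_gt0 _) F.
- by move: xmax_ge1; rewrite xmaxE leNgt ltNyr.
Unshelve. all: by end_near. Qed.

(** For infinite [xmin], choose [t] between [theta_inf] and [theta]: eventually the inverse of
    [ffact f (- n)] is at most [expR (t * n)], against the factor [expR (- theta * n)]. *)
Lemma gibbs_tail_neg theta : dom theta ->
  exists s C, 0 < s /\
    forall n : nat, gibbs theta (- n%:Z) <= C * expR (- (s * n%:R)).
Proof.
move=> [thetaS _].
suff [s [s0 near1]] : exists s, 0 < s /\
    \forall n \near \oo, gibbs theta (- n%:Z) * expR (s * n%:R) <= 1.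
  have [C CE] := near_bounded near1; exists s, C; split => // n.
  by rewrite expRN ler_pdivlMr ?expR_gt0.
case xminE: xmin => [m| |].
- exists 1; split => //; near=> n.
  rewrite gibbs_out ?mul0r// => /int_intervalE[+ _]; rewrite xminE lee_fin.
  apply/negP; rewrite -ltNge.
  have : (`|m| < n)%N by near: n; exact: nbhs_infty_gt.
  by lia.
- by move: xmin_le0; rewrite xminE leNgt ltry.
- move: thetaS; rewrite /theta_inf xminE eqxx => /ereal_lt_real_lt[t [tt tS]].
  exists (theta - t); split; first by rewrite subr_gt0.
  move: tS => /gt_lne/lt_limn_esup_near nearS; near=> n.
  have n0 : (0 < n)%N by near: n; exact: nbhs_infty_gt.
  have : ((ffact f (- n%:Z) `^ (- n%:R^-1))%:E < (expR t)%:E)%E by near: n.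
  rewrite lte_fin => tn; have F : (ffact f (- n%:Z))^-1 <= expR (t * n%:R).
    have -> : (ffact f (- n%:Z))^-1 = (ffact f (- n%:Z) `^ (- n%:R^-1)) ^+ n.
      rewrite -powR_mulrn ?powR_ge0// -powRrM mulNr mulVf ?pnatr_eq0 -?lt0n//.
      by rewrite powR_inv1 ?ffact_ge0.
    rewrite expRM_natr.
    by rewrite lerXn2r ?nnegrE ?expR_ge0 ?powR_ge0// ltW.
  apply: (@le_trans _ _
      (expR (theta * - n%:R) * expR (t * n%:R) * expR ((theta - t) * n%:R))).
    rewrite ler_wpM2r ?expR_ge0//; apply: le_trans (gibbs_le _ _) _.
    by rewrite mulrNz ler_wpM2l ?expR_ge0.
  by rewrite -!expRD -expR0 ler_expR; lra.
Unshelve. all: by end_near. Qed.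

Lemma zsummable_gibbs theta : dom theta ->
  zsummable (fun x => (1 + x%:~R ^+ 2) * gibbs theta x).
Proof.
move=> dth; have [s1 [C1 [s10 H1]]] := gibbs_tail_pos dth.
have [s2 [C2 [s20 H2]]] := gibbs_tail_neg dth.
exact: (zsummable_decay (gibbs_ge0 theta) s10 s20 H1 H2).
Qed.

(** * Normalisation and likelihood ratios *)

Definition Zpart theta : R := zsum setT (gibbs theta).

Lemma Zpart_gt0 theta : dom theta -> 0 < Zpart theta.
Proof.
move=> dth; apply: (@zsum_gt0 _ _ 0) => [x||]; first exact: gibbs_ge0.
- exact: zsummable_quad1 (zsummable_gibbs dth).
- by apply: gibbs_gt0; left.
Qed.

Definition pmf theta x : R := (Zpart theta)^-1 * gibbs theta x.

Lemma mu_pmf theta x : I x -> mu xmin xmax f theta x = pmf theta x.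
Proof.
move=> Ix; rewrite /mu /pmf /Zpart gibbsE// zsumE mulrC.
by congr ((zsum setT _)^-1 * _); apply/funext.
Qed.

Lemma pmf_out theta x : ~ I x -> pmf theta x = 0.
Proof. by move=> Ix; rewrite /pmf gibbs_out// mulr0. Qed.

Lemma pmf_ge0 theta x : 0 <= pmf theta x.
Proof. by rewrite mulr_ge0 ?gibbs_ge0// invr_ge0 zsum_ge0// => y; exact: gibbs_ge0. Qed.

Lemma second_order_pmf theta : dom theta -> second_order (pmf theta).
Proof.
move=> dth; split; first exact: pmf_ge0.
- rewrite (_ : (fun x => _) =
      fun x => (Zpart theta)^-1 * ((1 + x%:~R ^+ 2) * gibbs theta x)).
    exact/zsummableZ/zsummable_gibbs.
  by apply/funext => x; rewrite /pmf mulrCA.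
- rewrite /pmf zsumZ; last exact: zsummable_quad1 (zsummable_gibbs dth).
  by rewrite mulVf// gt_eqF// Zpart_gt0.
Qed.

(** The likelihood ratio is a constant times an exponential, the form that [zconvex_expR] shows to
    be convex. *)
Lemma pmf_tilt theta theta' x : dom theta ->
  pmf theta' x = Zpart theta / Zpart theta' *
    expR ((theta' - theta) * x%:~R) * pmf theta x.
Proof.
move=> dth; rewrite /pmf (gibbs_tilt theta theta').
have Z0 : Zpart theta != 0 by rewrite gt_eqF// Zpart_gt0.
move: (Zpart theta) (Zpart theta') (expR _) (gibbs _ x) Z0 => Z Z' e g Z0.
by rewrite [RHS]mulrACA [Z / Z' / Z]mulrAC (divff Z0) mul1r.
Qed.

(** * Moments of [mu_prob] as sums against [pmf] *)

Lemma mu_measure_set1 theta x :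
  mu_measure xmin xmax f theta [set x] = (pmf theta x)%:E.
Proof.
rewrite /mu_measure; have [Ix|Ix] := pselect (I x).
  by rewrite set1I mem_set//= esum_set1 ?mu_pmf// lee_fin pmf_ge0.
by rewrite set1I memNset//= esum_set0 pmf_out.
Qed.

(** This is the premise of [mu_probE], by which [mu_prob] and [mu_measure] agree on [dom]. *)
Lemma mu_measureT theta : dom theta -> mu_measure xmin xmax f theta setT = 1%E.
Proof.
move=> dth; have [p0 p2 p1] := second_order_pmf dth.
rewrite /mu_measure setTI esum_mkcond.
rewrite (eq_esum (b := fun x => (pmf theta x)%:E)).
  rewrite -integral_counting_esum//.
  have := EFin_zsum (zsummable_weight (second_order_pmf dth)).
  by rewrite p1 => <-.
move=> x _; case: ifPn => [|]; rewrite ?inE ?notin_setE => Ix; first by rewrite mu_pmf.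
by rewrite pmf_out.
Qed.

Lemma expectation_mu_prob theta (u : int -> R) : dom theta ->
  zsummable (fun x => u x * pmf theta x) ->
  ('E_(mu_prob xmin xmax f theta)[u] =
   (zsum setT (fun x => u x * pmf theta x))%:E)%E.
Proof.
move=> dth su; rewrite expectation.unlock.
apply: integral_zsum_density => // x; first exact: pmf_ge0.
rewrite -mu_measure_set1.
exact: (congr1 (fun m => m [set x]) (mu_probE (mu_measureT dth))).
Qed.

Lemma varrhoE theta : dom theta -> varrho xmin xmax f theta = mean (pmf theta).
Proof.
move=> dth; rewrite /varrho expectation_mu_prob//.
exact: (zsummable_id (second_order_pmf dth)).
Qed.

Lemma mu_varE theta : dom theta -> mu_var xmin xmax f theta = var (pmf theta).
Proof.
move=> dth; rewrite /mu_var /variance covariance.unlock -/(varrho _ _ _ _) varrhoE//.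
have sV := zsummable_sqB (second_order_pmf dth) (mean (pmf theta)).
by rewrite expectation_mu_prob.
Qed.

(** The points 0 and 1 both carry mass, and the mean differs from at least one of them. *)
Lemma var_pmf_gt0 theta : dom theta -> 0 < var (pmf theta).
Proof.
move=> dth; have sV := zsummable_sqB (second_order_pmf dth) (mean (pmf theta)).
have p0 x : x = 0 \/ x = 1 -> 0 < pmf theta x.
  by move=> x01; rewrite mulr_gt0 ?gibbs_gt0// invr_gt0 Zpart_gt0.
have V0 x : 0 <= (x%:~R - mean (pmf theta)) ^+ 2 * pmf theta x.
  by rewrite mulr_ge0 ?sqr_ge0 ?pmf_ge0.
have [m0|m0] := eqVneq (mean (pmf theta)) 0.
- apply: (zsum_gt0 (x := 1) V0 sV).
  by rewrite m0 mulr1z subr0 expr1n mul1r p0//; right.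
- apply: (zsum_gt0 (x := 0) V0 sV).
  by rewrite mulr0z sub0r sqrrN mulr_gt0 ?exprn_even_gt0// p0//; left.
Qed.

(** * The inverse parameter, and summation by parts for [nu] *)

Lemma theta_of_dom rho : (varrho xmin xmax f @` dom) rho ->
  dom (theta_of xmin xmax f rho).
Proof. by move=> rhoI; exact: (@funS _ _ _ _ ('pinv_(cst 0) dom _)). Qed.

Lemma theta_ofK rho : (varrho xmin xmax f @` dom) rho ->
  varrho xmin xmax f (theta_of xmin xmax f rho) = rho.
Proof. by move=> rhoI; apply: pinvK; rewrite inE. Qed.

(** As [y] is at least [xmin], any [x > y] respects the lower end of [I]; the index set in [nu] is
    thus the part of [I] above [y]. *)
Lemma nu_dom_step (x y : int) : nu_dom xmin xmax y ->
  (y + 1 <= x /\ (x%:E <= xmax)%E) <-> (y < x /\ I x).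
Proof.
move=> [xminy _]; split => [[yx xM]|[yx /int_intervalE[_ xM]]].
  split; first by rewrite -ltzD1 ltrD2r in yx *; lia.
  apply/int_intervalE; split => //; apply: le_trans xminy _.
  by rewrite lee_fin; lia.
by split => //; lia.
Qed.

(** Such a [y] is at least [xmax] or below [xmin], hence on the same side of [x] and of 0, and the
    two indicators cancel. This extends the sum over [nu_dom] to all of [int]. *)
Lemma step_kernel_out (x y : int) : I x -> ~ nu_dom xmin xmax y ->
  step_kernel x y = 0 :> R.
Proof.
move=> /int_intervalE[mx xM] ynu; rewrite /step_kernel.
have [xminy|yxmin] := leP xmin y%:E.
  have xmaxy : (xmax <= y%:E)%E.
    by rewrite leNgt; apply/negP => yxmax; apply: ynu.
  have xy : x <= y by rewrite -lee_fin (le_trans xM).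
  have y1 : 1 <= y by rewrite -lee_fin (le_trans xmax_ge1).
  by rewrite !ltNge xy (le_trans _ y1)// subrr.
have yx : y < x by rewrite -lte_fin (lt_le_trans yxmin).
have y0 : y < 0 by rewrite -lte_fin (lt_le_trans yxmin).
by rewrite yx y0 subrr.
Qed.

Lemma nu_step_kernel theta y : dom theta -> nu_dom xmin xmax y ->
  nu xmin xmax f theta y = (var (pmf theta))^-1 *
    zsum setT (fun x => step_kernel x y *
      ((x%:~R - mean (pmf theta)) * pmf theta x)).
Proof.
move=> dth ynu; rewrite /nu mu_varE// varrhoE//; congr (_ * _).
set m := mean _; set A := [set x | _].
have p2 := second_order_pmf dth.
have sB := zsummable_idB p2 m.
have sI (P : int -> bool) :
    zsummable (fun x => (P x)%:R * ((x%:~R - m) * pmf theta x)).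
  apply: zsummable_le sB => x; rewrite normrM normr_nat.
  by case: (P x); rewrite ?mul1r ?mul0r.
rewrite zsumE (eq_zsum (g := fun x =>
    (y < x)%R%:R * ((x%:~R - m) * pmf theta x))); last first.
  move=> x _; rewrite patchE; case: ifPn; rewrite ?inE ?notin_setE /A /= => Ax.
    have [yx Ix] := (nu_dom_step x ynu).1 Ax.
    by rewrite yx mul1r mu_pmf.
  have [Ix|Ix] := pselect (I x); last by rewrite pmf_out// !mulr0.
  case: (ltP y x) => yx; last by rewrite mul0r.
  by exfalso; apply: Ax; apply/(nu_dom_step x ynu).
(* The subtracted term is zero by [meanB_eq0]; it turns the indicator of [y < x] into
   [step_kernel]. *)
transitivity (zsum setT (fun x => (y < x)%R%:R * ((x%:~R - m) * pmf theta x)) -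
    (y < 0)%R%:R * zsum setT (fun x => (x%:~R - m) * pmf theta x)).
  by rewrite (meanB_eq0 p2) mulr0 subr0.
rewrite -(zsumZ _ sB) -zsumB; [|exact: sI|exact: zsummableZ].
by apply: eq_zsum => x _; rewrite /step_kernel [RHS]mulrBl.
Qed.

(** Summation by parts as an exchange of sums: summing the kernel against [phi] over [y] first
    produces [step_primitive phi x]. *)
Lemma zsum_nu theta (phi : int -> R) (C : R) : dom theta ->
  (forall y, `|phi y| <= C) ->
  zsum (nu_dom xmin xmax) (fun y => phi y * nu xmin xmax f theta y) =
  cov (pmf theta) (step_primitive phi) / var (pmf theta).
Proof.
move=> dth phiC; set p := pmf theta; have p2 := second_order_pmf dth.
have sB := zsummable_idB p2 (mean p).
pose c x : R := (x%:~R - mean p) * p x / var p.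
pose a x y : R := c x * (step_kernel x y * phi y).
have sK x : zsummable (fun y => step_kernel x y * phi y).
  exact: zsummable_step_kernel.
have sa x : zsummable (fun y => a x y) by exact/zsummableZ/sK.
pose S x := zsum setT (fun y => `|step_kernel x y * phi y|).
have SC x : `|S x| <= C * `|x%:~R|.
  by rewrite ger0_norm ?zsum_ge0//; exact: step_primitive_bound.
have PhiC x := norm_step_primitive x phiC.
transitivity (zsum setT (fun y => zsum setT (fun x => a x y))).
  rewrite zsumE; apply: eq_zsum => y _; rewrite patchE.
  case: ifPn; rewrite ?inE ?notin_setE => ynu.
    rewrite nu_step_kernel// -/p mulrA -zsumZ.
      by apply: eq_zsum => x _; rewrite /a /c; ring.
    apply: zsummable_le sB => x; rewrite normrM ler_piMl//.
    by rewrite /step_kernel; case: (y < x); case: (y < 0);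
      rewrite ?subrr ?subr0 ?sub0r ?normrN ?normr0 ?normr1.
  rewrite (eq_zsum (g := fun=> 0)); first by rewrite /zsum Rintegral_cst// mul0r.
  move=> x _; rewrite /a; have [Ix|Ix] := pselect (I x).
    by rewrite step_kernel_out// mul0r mulr0.
  by rewrite /c /p pmf_out// mulr0 !mul0r.
rewrite -zsum_exchange; first last.
(* Absolute summability of the double family: [S] grows at most linearly, so [zsummable_cov] applies
   with [S] in the place of [Phi]. *)
- apply: zsummable_le (zsummableZ (var p)^-1 (zsummable_cov p2 SC)) => x.
  rewrite (eq_zsum (g := fun y => `|c x| * `|step_kernel x y * phi y|)); last first.
    by move=> y _; rewrite normrM.
  rewrite zsumZ; last exact/zsummable_norm/sK.
  rewrite -/(S x) normrM normr_id /c !normrM.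
  by rewrite le_eqVlt; apply/orP; left; apply/eqP; ring.
- exact: sa.
rewrite /cov mulrC -zsumZ; last exact: (zsummable_cov p2 PhiC).
apply: eq_zsum => x _; rewrite (zsumZ _ (sK x)) -/(step_primitive phi x) /c.
by ring.
Qed.

Lemma cov_var_pmf_monotone theta1 theta2 (phi : int -> R) (C : R) :
  dom theta1 -> dom theta2 -> (forall y, `|phi y| <= C) ->
  {homo phi : x y / x <= y} -> mean (pmf theta1) < mean (pmf theta2) ->
  cov (pmf theta1) (step_primitive phi) / var (pmf theta1) <=
  cov (pmf theta2) (step_primitive phi) / var (pmf theta2).
Proof.
move=> d1 d2 phiC phi_mon m12.
have Z1 := Zpart_gt0 d1; have Z2 := Zpart_gt0 d2.
have ratio_ge0 (u v : R) : 0 < u -> 0 < v -> 0 <= u / v.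
  by move=> u0 v0; rewrite divr_ge0// ltW.
have [e Le] := zconvex_expR (theta2 - theta1) (ratio_ge0 _ _ Z1 Z2).
have [e' Le'] := zconvex_expR (theta1 - theta2) (ratio_ge0 _ _ Z2 Z1).
apply: (slope_monotone (second_order_pmf d1) (second_order_pmf d2)
  (fun x => norm_step_primitive x phiC) (var_pmf_gt0 d1) (var_pmf_gt0 d2)
  (zconvex_step_primitive phi_mon) Le _ _ Le' _ _ m12) => x.
- by rewrite mulr_ge0 ?expR_ge0 ?ratio_ge0.
- exact: pmf_tilt.
- by rewrite mulr_ge0 ?expR_ge0 ?ratio_ge0.
- exact: pmf_tilt.
Qed.

End exponential_family.

Theorem proposition3p3 (R : realType) (xmin xmax : \bar int)
    (f : int -> {nonneg R})
    (xmin_le0 : (xmin <= 0)%E) (xmax_ge1 : (1 <= xmax)%E)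
    (f_gt0 : forall x : int, int_interval xmin xmax x ->
      (xmin < x%:E)%E -> 0 < (f x)%:num)
    (theta_inf_lt0 : (theta_inf xmin f < 0)%E)
    (theta_sup_gt0 : (0 < theta_sup xmax f)%E)
    (phi : int -> R) (phi_bounded : bounded_fun phi)
    (phi_nondecreasing : {homo phi : x y / x <= y})
    (rho1 rho2 : R)
    (rho1_range : (varrho xmin xmax f @` theta_dom xmin xmax f) rho1)
    (rho2_range : (varrho xmin xmax f @` theta_dom xmin xmax f) rho2)
    (rho12 : rho1 <= rho2) :
  zsum (nu_dom xmin xmax)
    (fun y => phi y * nu xmin xmax f (theta_of xmin xmax f rho1) y) <=
  zsum (nu_dom xmin xmax)
    (fun y => phi y * nu xmin xmax f (theta_of xmin xmax f rho2) y).
Proof.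
have [M [_ phiM]] := phi_bounded.
(* Boundedness supplies every real strictly above [M] as a bound. *)
have phiC y : `|phi y| <= M + 1 by apply: phiM; rewrite ?ltrDl.
have d1 := theta_of_dom rho1_range; have d2 := theta_of_dom rho2_range.
rewrite [leLHS](zsum_nu xmin_le0 xmax_ge1 f_gt0 d1 phiC).
rewrite [leRHS](zsum_nu xmin_le0 xmax_ge1 f_gt0 d2 phiC).
(* Equality is set apart because [slope_monotone] divides by the difference of the means. *)
move: rho12; rewrite le_eqVlt => /predU1P[->|rho12']; first exact: lexx.
apply: (cov_var_pmf_monotone xmin_le0 xmax_ge1 f_gt0 d1 d2 phiC).
  exact: phi_nondecreasing.
rewrite -(varrhoE xmin_le0 xmax_ge1 f_gt0 d1) -(varrhoE xmin_le0 xmax_ge1 f_gt0 d2).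
by rewrite (theta_ofK rho1_range) (theta_ofK rho2_range).
Qed.
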